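(* Suppose $(X,A)$ is a suspension pair and $r\ge1$. Let $H_{r-1}\colon A_\infty\to (A^{(r-1)})_\infty$ be any map. Then there is a map $$h\colon(X,A)_\infty\to(X\wedge A^{(r-1)},A^{(r)})_\infty$$ such that the composition $$X\times A_\infty\to(X,A)_\infty\xrightarrow{h}(X\wedge A^{(r-1)},A^{(r)})_\infty\xrightarrow{\rho}X\wedge A^{(r-1)}/A^{(r)}$$ is homotopic to the composition $$X\times A_\infty\xrightarrow{1\times H_{r-1}}X\times (A^{(r-1)})_\infty\to X\wedge (A^{(r-1)})_\infty\xrightarrow{\alpha}X\wedge A^{(r-1)}\to X\wedge A^{(r-1)}/A^{(r)}.$$
   Context: Spaces are pointed and localized at a fixed prime $p>2$. $Y_\infty$ is the James reduced product of $Y$ (free topological monoid on $Y$ with the basepoint as unit), a model for $\Omega\Sigma Y$ when $Y$ is connected. $A^{(k)}$ is the $k$-fold smash power of $A$. For a pair $A\subset X$ (the inclusion a cofibration), $(X,A)_\infty\subset X_\infty$ is the subspace of words all of whose letters after the first lie in $A$; it is a model for the homotopy fiber of the pinch map $X\cup CA\to\Sigma A$. The map $X\times A_\infty\to(X,A)_\infty$ is $(x,w)\mapsto xw$. The map $\rho\colon(X,A)_\infty\to X/A$ is the quotient by the action of the monoid $A_\infty$ (it takes a word to the class of its first letter); it is used here for the pair $(X\wedge A^{(r-1)},A^{(r)})$, $A^{(r)}=A\wedge A^{(r-1)}\subset X\wedge A^{(r-1)}$. A suspension pair is a pair of the form $(X,A)=(\Sigma X',\Sigma A')$ with $A'\subset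 X'$. With $X=\Sigma X'$, the map $\alpha\colon X\wedge B_\infty\to X\wedge B$ ($B=A^{(r-1)}$) is $X'\wedge\Sigma B_\infty\to X'\wedge\Sigma B$ induced by the retraction $\Sigma B_\infty\to\Sigma B$ (James map $B_\infty\to\Omega\Sigma B$ followed by evaluation). Unlabelled maps are the canonical quotient maps. *)

(* Defs.v *)
From HB Require Import structures.
From mathcomp Require Import all_boot all_order all_algebra generic_quotient.
From mathcomp Require Import all_classical all_reals topology normedtype.

Set Implicit Arguments.
Unset Strict Implicit.
Unset Printing Implicit Defensive.

Import Order.TTheory GRing.Theory Num.Theory numFieldNormedType.Exports.

Local Open Scope classical_set_scope.
Local Open Scope ring_scope.
Local Open Scope quotient_scope.

(* Test maps from arbitrary compact Hausdorff spaces (rather than compact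
   subspaces of T) give the right notion without assuming T Hausdorff. *)
Definition kopen (T : topologicalType) (U : set T) : Prop :=
  forall (K : topologicalType) (f : K -> T),
    compact [set: K] -> hausdorff_space K -> continuous f -> open (f @^-1` U).

Definition compactly_generated (T : topologicalType) : Prop :=
  forall U : set T, kopen U -> open U.

Definition weak_hausdorff (T : topologicalType) : Prop :=
  forall (K : topologicalType) (f : K -> T),
    compact [set: K] -> hausdorff_space K -> continuous f -> closed (range f).

Definition kification (T : Type) : Type := T.

Section kification_topology.
Context (T : topologicalType).

HB.instance Definition _ := Choice.copy (kification T) T.

Local Lemma kopenT : @kopen T setT.
Proof. by move=> K f _ _ _; rewrite preimage_setT; exact: openT. Qed.

Local Lemma kopenI : setI_closed (@kopen T).
Proof.
move=> U V oU oV K f cK hK cf; rewrite preimage_setI.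
by apply: openI; [exact: oU | exact: oV].
Qed.

Local Lemma kopen_bigU (I : Type) (F : I -> set T) :
  (forall i, kopen (F i)) -> kopen (\bigcup_i F i).
Proof.
move=> oF K f cK hK cf; rewrite preimage_bigcup.
by apply: bigcup_open => i _; exact: oF.
Qed.

HB.instance Definition _ :=
  isOpenTopological.Build (kification T) kopenT kopenI kopen_bigU.

End kification_topology.

HB.instance Definition _ (T : ptopologicalType) :=
  isPointed.Build (kification T) (point : T).

HB.instance Definition _ (X Y : ptopologicalType) := Pointed.on (X * Y)%type.

(* Products are taken in the category of compactly generated spaces. *)
Notation kprod X Y := (kification (X * Y)%type).

Section interval.
Context (R : realType).

Definition unit_interval : Type := set_type (`[0, 1]%classic : set R).

HB.instance Definition _ :=
  Topological.copy unit_interval (set_type (`[0, 1]%classic : set R)).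

Definition uval (t : unit_interval) : R := set_val t.

Local Lemma mem_unit0 : (0 : R) \in (`[0, 1]%classic : set R).
Proof. by apply: mem_set; rewrite /= in_itv /= lexx ler01. Qed.

Local Lemma mem_unit1 : (1 : R) \in (`[0, 1]%classic : set R).
Proof. by apply: mem_set; rewrite /= in_itv /= lexx ler01. Qed.

Definition unit0 : unit_interval := SigSub mem_unit0.
Definition unit1 : unit_interval := SigSub mem_unit1.

HB.instance Definition _ := isPointed.Build unit_interval unit0.

(* Only used for s in [0, 1]; other reals are sent to 0. *)
Definition to_unit (s : R) : unit_interval := insubd unit0 s.

Definition homotopic (X Y : ptopologicalType) (f g : X -> Y) : Prop :=
  exists F : kprod X unit_interval -> Y,
    [/\ continuous F,
        forall x, F (x, unit0) = f x,
        forall x, F (x, unit1) = g x &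
        forall t, F (point, t) = point].

Definition cofibration (A X : topologicalType) (i : A -> X) : Prop :=
  continuous i /\
  forall (Y : topologicalType) (f : X -> Y) (G : kprod A unit_interval -> Y),
    continuous f -> continuous G -> (forall a, G (a, unit0) = f (i a)) ->
    exists F : kprod X unit_interval -> Y,
      [/\ continuous F,
          forall x, F (x, unit0) = f x &
          forall a t, F (i a, t) = G (a, t)].

End interval.

(* A subspace A of X is given by its embedding i.  Closedness costs nothing:
   cofibrations of compactly generated weak Hausdorff spaces are closed. *)
Definition closed_inclusion (A X : ptopologicalType) (i : A -> X) : Prop :=
  [/\ continuous i, injective i, i point = point &
      forall C : set A, closed C -> closed (i @` C)].

Section collapse.
Context (T : topologicalType) (S : set T).

Let crel (a b : T) : bool := (a == b) || ((a \in S) && (b \in S)).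

Local Lemma crel_refl : reflexive crel.
Proof. by move=> a; rewrite /crel eqxx. Qed.

Local Lemma crel_sym : symmetric crel.
Proof. by move=> a b; rewrite /crel eq_sym andbC. Qed.

Local Lemma crel_trans : transitive crel.
Proof.
move=> b a c; rewrite /crel => /orP[/eqP->//|/andP[aS bS]].
by move=> /orP[/eqP<-|/andP[_ cS]]; rewrite aS ?bS ?cS orbT.
Qed.

Definition collapse_rel := EquivRel crel crel_refl crel_sym crel_trans.

Definition collapse : Type := {eq_quot collapse_rel}.

HB.instance Definition _ :=
  Topological.copy collapse (quotient_topology {eq_quot collapse_rel}).
HB.instance Definition _ := Quotient.on collapse.

Definition collapse_pi : T -> collapse := \pi_collapse.

Definition collapse_repr (q : collapse) : T := repr q.

End collapse.

HB.instance Definition _ (T : ptopologicalType) (S : set T) :=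
  isPointed.Build (collapse S) (collapse_pi S point).

Section suspension.
Context (R : realType).

Definition susp_base (X : ptopologicalType) : set (kprod X (unit_interval R)) :=
  [set xt | [\/ xt.1 = point, xt.2 = unit0 R | xt.2 = unit1 R]].

Definition Susp (X : ptopologicalType) : ptopologicalType :=
  @collapse (kprod X (unit_interval R)) (@susp_base X).

Definition susp_pi (X : ptopologicalType) (x : X) (t : unit_interval R) :
  Susp X := @collapse_pi (kprod X (unit_interval R)) (@susp_base X) (x, t).

Definition susp_map (X Y : ptopologicalType) (f : X -> Y) (q : Susp X) :
  Susp Y := let: (x, t) := collapse_repr q in susp_pi (f x) t.

End suspension.

Definition smash_base (X Y : ptopologicalType) : set (kprod X Y) :=
  [set xy | xy.1 = point \/ xy.2 = point].

Definition Smash (X Y : ptopologicalType) : ptopologicalType :=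
  @collapse (kprod X Y) (@smash_base X Y).

Definition smash_pi (X Y : ptopologicalType) (x : X) (y : Y) : Smash X Y :=
  @collapse_pi (kprod X Y) (@smash_base X Y) (x, y).

Definition smash_map (X X1 Y Y1 : ptopologicalType) (f : X -> X1) (g : Y -> Y1)
  (q : Smash X Y) : Smash X1 Y1 :=
  let: (x, y) := collapse_repr q in smash_pi (f x) (g y).

Definition S0 : ptopologicalType := bool.

Fixpoint smash_pow (A : ptopologicalType) (k : nat) : ptopologicalType :=
  if k is k'.+1 then Smash A (smash_pow A k') else S0.

(* X / A, for A a subspace of X embedded by i. *)
Definition quotient_by (A X : ptopologicalType) (i : A -> X) :
  ptopologicalType := collapse (range i).

Section local.
Context (R : realType).

Fixpoint sphere (n : nat) : ptopologicalType :=
  if n is n'.+1 then Susp R (sphere n') else S0.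

(* [y, t] |-> [y, q t mod 1]: q times the identity for the suspension
   comultiplication. *)
Definition susp_degree (q : nat) (Y : ptopologicalType) (z : Susp R Y) :
  Susp R Y :=
  let: (y, t) := collapse_repr z in
  let s := q%:R * uval t in
  susp_pi y (to_unit (s - (Num.floor s)%:~R)).

(* For every n >= 1 and every prime q != p, the q-th power map of pi_n(Z) is
   bijective, i.e. homotopy groups are uniquely q-divisible.  For simply
   connected Z this says that they are modules over the integers localized at
   p. *)
Definition p_local (p : nat) (Z : ptopologicalType) : Prop :=
  forall (n q : nat), prime q -> q != p ->
    (forall f : sphere n.+1 -> Z, continuous f -> f point = point ->
      exists g : sphere n.+1 -> Z,
        [/\ continuous g, g point = point &
            homotopic R (g \o @susp_degree q (sphere n)) f]) /\
    (forall g1 g2 : sphere n.+1 -> Z,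
      continuous g1 -> g1 point = point ->
      continuous g2 -> g2 point = point ->
      homotopic R (g1 \o @susp_degree q (sphere n))
                  (g2 \o @susp_degree q (sphere n)) ->
      homotopic R g1 g2).

End local.

Fixpoint kpow (Y : topologicalType) (n : nat) : topologicalType :=
  if n is n'.+1 then kprod Y (kpow Y n') else discrete_topology unit.

Fixpoint letters (Y : topologicalType) (n : nat) : kpow Y n -> seq Y :=
  if n is n'.+1 then fun v => v.1 :: letters v.2 else fun=> [::].

(* Elements of Y_oo are words in reduced form: no letter is the basepoint. *)
Definition James (Y : ptopologicalType) : Type :=
  {w : seq Y | point \notin w}.

Section james.
Context (Y : ptopologicalType).

HB.instance Definition _ := Choice.on (James Y).

Definition word (w : James Y) : seq Y := sval w.

Local Lemma reduce_subproof (s : seq Y) :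
  point \notin [seq y <- s | y != point].
Proof. by rewrite mem_filter eqxx. Qed.

Definition reduce (s : seq Y) : James Y :=
  exist (fun w : seq Y => point \notin w) _ (reduce_subproof s).

(* The quotient topology of the disjoint union of the powers Y^n. *)
Definition james_open (U : set (James Y)) : Prop :=
  forall n, open [set v : kpow Y n | U (reduce (letters v))].

Local Lemma james_openT : james_open setT.
Proof. by move=> n; exact: openT. Qed.

Local Lemma james_openI : setI_closed james_open.
Proof. by move=> U V oU oV n; exact: openI (oU n) (oV n). Qed.

Local Lemma james_open_bigU (I : Type) (F : I -> set (James Y)) :
  (forall i, james_open (F i)) -> james_open (\bigcup_i F i).
Proof.
move=> oF n.
have -> : [set v : kpow Y n | (\bigcup_i F i) (reduce (letters v))] =
    \bigcup_i [set v : kpow Y n | F i (reduce (letters v))] by [].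
by apply: bigcup_open => i _; exact: oF.
Qed.

HB.instance Definition _ :=
  isOpenTopological.Build (James Y) james_openT james_openI james_open_bigU.
HB.instance Definition _ := isPointed.Build (James Y) (reduce [::]).

End james.

Section relative_james.
Context (A X : ptopologicalType) (i : A -> X).

(* X_oo here consists of reduced words, so the unit is the empty word and the
   condition on the letters after the first one is a condition on behead. *)
Definition later_letters : set (James X) :=
  [set w | forall x, x \in behead (word w) -> range i x].

Definition RelJames : Type := kification (set_type later_letters).

HB.instance Definition _ := Topological.on RelJames.

Local Lemma rel_point_subproof : (point : James X) \in later_letters.
Proof. by apply: mem_set. Qed.

HB.instance Definition _ :=
  isPointed.Build RelJames (SigSub rel_point_subproof).

Local Lemma rel_mul_subproof (x : X) (w : James A) :
  reduce (x :: [seq i a | a <- word w]) \in later_letters.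
Proof.
apply: mem_set => y; rewrite /word /=.
have h s : y \in [seq z <- [seq i a | a <- s] | z != point] -> range i y.
  by rewrite mem_filter => /andP[_ /mapP[a _ ->]]; exists a.
by case: ifP => _ /=; [exact: h | move=> /mem_behead; exact: h].
Qed.

Definition rel_mul (xw : kprod X (James A)) : RelJames :=
  SigSub (rel_mul_subproof xw.1 xw.2).

(* The class of the first letter; the empty word goes to the basepoint. *)
Definition rel_rho (w : RelJames) : quotient_by i :=
  collapse_pi _ (head point (word (set_val w))).

End relative_james.

Section james_map.
Context (R : realType) (B : ptopologicalType).

(* The lengths of the Moore loops assigned to the letters.  Such a function
   exists whenever the basepoint of B is nondegenerate; up to homotopy the maps
   below do not depend on it. *)
Definition letter_length (u : B -> R) : Prop :=
  [/\ continuous u, forall b, 0 <= u b & forall b, u b = 0 <-> b = point].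

Variable u : B -> R.

(* The Moore loop of length u(b_1) + ... + u(b_n) in Susp B which follows
   s |-> [b_1, s / u(b_1)], then s |-> [b_2, s / u(b_2)], and so on. *)
Fixpoint moore_loop (w : seq B) (s : R) : Susp R B :=
  if w is b :: w' then
    if s <= u b then susp_pi b (to_unit (s / u b))
    else moore_loop w' (s - u b)
  else point.

(* Adjoint of the canonical map from James B to loops in Susp B, the Moore loop
   being reparametrized by [0, 1]. *)
Definition james_map (w : James B) (t : unit_interval R) : Susp R B :=
  moore_loop (word w) (uval t * \sum_(b <- word w) u b).

Definition james_retraction (q : Susp R (James B)) : Susp R B :=
  let: (w, t) := collapse_repr q in james_map w t.

End james_map.

Section alpha.
Context (R : realType) (X' : ptopologicalType).

(* The mutually inverse homeomorphisms moving the suspension coordinate. *)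
Definition susp_right (C : ptopologicalType) (q : Smash (Susp R X') C) :
  Smash X' (Susp R C) :=
  let: (z, c) := collapse_repr q in
  let: (x, t) := collapse_repr z in smash_pi x (susp_pi c t).

Definition susp_left (C : ptopologicalType) (q : Smash X' (Susp R C)) :
  Smash (Susp R X') C :=
  let: (x, z) := collapse_repr q in
  let: (c, t) := collapse_repr z in smash_pi (susp_pi x t) c.

Definition alpha (B : ptopologicalType) (u : B -> R) :
  Smash (Susp R X') (James B) -> Smash (Susp R X') B :=
  @susp_left B \o smash_map idfun (james_retraction u) \o @susp_right (James B).

End alpha.

(* Main.v *)
Require Import Defs.
From mathcomp Require Import all_boot all_order all_algebra generic_quotient.
From mathcomp Require Import all_classical all_reals topology normedtype.
Import numFieldNormedType.Exports.

Set Implicit Arguments.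
Unset Strict Implicit.
Unset Printing Implicit Defensive.

Import Order.TTheory GRing.Theory Num.Theory.
Local Open Scope classical_set_scope.
Local Open Scope ring_scope.

(** The map h can be written down letter by letter.  Put
    theta(x, w) = alpha(x /\ H(w)), and let

      h(x a_1 ... a_n) =
        theta(x, a_1 ... a_n) theta(a_1, a_2 ... a_n) ... theta(a_n, 1).

    Every letter but the first has the form theta(a, w) with a in A, and lies
    in A /\ B because alpha is natural in the desuspension of its first factor
    ([alpha_natural]).  Since theta(point, w) is the basepoint, a letter of the
    source that is the basepoint contributes an empty letter to the target,
    so the formula respects the identification of words; in particular
    x = point gives the same value as the word a_1 ... a_n with a_1 as its
    first letter.  The class of the first letter of h(x w) modulo A /\ B is
    that of theta(x, w): if theta(x, w) is the basepoint, the next surviving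
    letter is in A /\ B, which is collapsed.  The square thus commutes on the
    nose ([rel_rho_ext]), and the constant homotopy finishes the proof.

    The work is in the continuity of h and of theta.

    - The spaces in question are compactly generated: openness is tested by
      probes, continuous maps from compact Hausdorff spaces.  Continuity into a
      product can be checked componentwise on a compactly generated source.  The
      product of a quotient map with an identity is a quotient map for these
      products ([kprod_quotient_continuous]); this yields continuity of maps out
      of smash products of suspensions and out of James B times the interval.

    - The retraction of Susp (James B) onto Susp B traces Moore loops, which are
      pasted from single letters.  At a letter of length 0, where the
      parametrization s / u(b) degenerates, continuity comes from the
      compactness of the interval: a neighbourhood of the basepoint of Susp B
      contains the whole line over every b close to the basepoint
      ([continuous_letter_path]).

    - The relative James construction is topologized as a subspace of James X,
      while the formula for h is visibly continuous only on the products of X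
      with powers of A.  These detect closed sets ([closed_later_letters])
      because A is closed in X ([closed_susp_map]) and products of closed
      inclusions are closed inclusions ([closed_kmap]). *)

(** * Compactly generated spaces and their products *)

Lemma continuous_compose (S T U : topologicalType) (f : S -> T) (g : T -> U) :
  continuous f -> continuous g -> continuous (fun s => g (f s)).
Proof. by move=> cf cg s; apply: (continuous_comp (cf s) (cg (f s))). Qed.

Lemma continuous_pair (S T U : topologicalType) (f : S -> T) (g : S -> U) :
  continuous f -> continuous g -> continuous (fun s => (f s, g s) : T * U).
Proof. by move=> cf cg s; apply: cvg_pair; [exact: cf | exact: cg]. Qed.

Lemma continuous_fst (T U : topologicalType) :
  continuous (fst : T * U -> T).
Proof. by move=> p; exact: cvg_fst. Qed.

Lemma continuous_snd (T U : topologicalType) :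
  continuous (snd : T * U -> U).
Proof. by move=> p; exact: cvg_snd. Qed.

Lemma open_kificationE (T : topologicalType) (U : set T) :
  @open (kification T) U = kopen U.
Proof. by []. Qed.

Lemma cg_compact (K : topologicalType) :
  compact [set: K] -> hausdorff_space K -> compactly_generated K.
Proof. by move=> cK hK U /(_ K idfun cK hK); apply=> x. Qed.

(** A probe of S composed with f is a probe of T, so the finer topology on the
    target costs nothing when S is compactly generated. *)
Lemma continuous_kification (S T : topologicalType) (f : S -> T) :
  compactly_generated S -> continuous f ->
  continuous (f : S -> kification T).
Proof.
move=> cgS cf; apply/continuousP => U oU; apply: cgS => K k cK hK ck.
rewrite -comp_preimage; apply: (oU K (f \o k)) => //.
exact: continuous_compose.
Qed.

Lemma continuous_unkification (T : topologicalType) :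
  continuous (idfun : kification T -> T).
Proof.
apply/continuousP => U oU; change (@kopen T U) => K k _ _ /continuousP.
by apply.
Qed.

Lemma cg_kification (T : topologicalType) : compactly_generated (kification T).
Proof.
move=> U oU; rewrite open_kificationE => K k cK hK ck; apply: (oU K k) => //.
by apply: continuous_kification => //; exact: cg_compact.
Qed.

Lemma continuous_kpair (S X Y : topologicalType) (f : S -> X) (g : S -> Y) :
  compactly_generated S -> continuous f -> continuous g ->
  continuous (fun s => (f s, g s) : kprod X Y).
Proof.
by move=> cgS cf cg; apply: continuous_kification => //; exact: continuous_pair.
Qed.

Lemma continuous_kfst (X Y : topologicalType) :
  continuous (fun p : kprod X Y => p.1).
Proof.
have h := @continuous_unkification (X * Y)%type.
exact: (@continuous_compose (kprod X Y) (X * Y)%type X _ _ h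
  (@continuous_fst X Y)).
Qed.

Lemma continuous_ksnd (X Y : topologicalType) :
  continuous (fun p : kprod X Y => p.2).
Proof.
have h := @continuous_unkification (X * Y)%type.
exact: (@continuous_compose (kprod X Y) (X * Y)%type Y _ _ h
  (@continuous_snd X Y)).
Qed.

Lemma continuous_kmap (X X1 Y Y1 : topologicalType) (f : X -> X1)
    (g : Y -> Y1) :
  continuous f -> continuous g ->
  continuous (fun p : kprod X Y => (f p.1, g p.2) : kprod X1 Y1).
Proof.
move=> cf cg; apply: continuous_kpair; first exact: cg_kification.
- exact: (continuous_compose (@continuous_kfst _ _)).
- exact: (continuous_compose (@continuous_ksnd _ _)).
Qed.

Lemma hausdorff_pair (T U : topologicalType) :
  hausdorff_space T -> hausdorff_space U -> hausdorff_space (T * U)%type.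
Proof.
move=> hT hU [a b] [c d] /= cl; congr pair.
- apply: hT => P Q nP nQ.
  have [] := cl (fst @^-1` P) (fst @^-1` Q); [exact: cvg_fst|exact: cvg_fst|].
  by move=> p [? ?]; exists p.1.
- apply: hU => P Q nP nQ.
  have [] := cl (snd @^-1` P) (snd @^-1` Q); [exact: cvg_snd|exact: cvg_snd|].
  by move=> p [? ?]; exists p.2.
Qed.

Lemma compact_pair (T U : topologicalType) :
  compact [set: T] -> compact [set: U] -> compact [set: (T * U)%type].
Proof. by move=> cT cU; rewrite -setXTT; exact: compact_setX. Qed.

Lemma hausdorff_set_type (T : topologicalType) (C : set T) :
  hausdorff_space T -> hausdorff_space (set_type C).
Proof.
move=> hT a b cl; apply: val_inj; apply: hT => P Q nP nQ.
have [] := cl (set_val @^-1` P) (set_val @^-1` Q).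
- exact: initial_continuous.
- exact: initial_continuous.
- by move=> p [? ?]; exists (set_val p).
Qed.

Lemma compact_set_type (T : topologicalType) (C : set T) :
  compact C -> compact [set: set_type C].
Proof.
move=> cC F FF _.
have FC : (set_val @ F) C.
  apply: (@filterS _ F _ setT); last exact: filterT.
  by move=> x _; apply: set_mem; move: x; exact: valP.
have [p [Cp clp]] := cC (set_val @ F) (fmap_proper_filter set_val FF) FC.
exists (SigSub (mem_set Cp)); split=> // P Q FP /= [_ [[V oV <-] Vp VQ]].
have [] := clp (set_val @` P) V.
- by apply: (@filterS _ F _ P) FP => x Px; exists x.
- exact: open_nbhs_nbhs.
- by move=> _ [[x Px <-] Vx]; exists x; split => //; exact: VQ.
Qed.

(** The preimage of C under l is the preimage of the closed set i(C) under the
    composite: a closed injection is an embedding. *)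
Lemma closed_injection_lift (K A X : topologicalType) (i : A -> X)
    (l : K -> A) :
  injective i -> (forall C : set A, closed C -> closed (i @` C)) ->
  continuous (fun k => i (l k)) -> continuous l.
Proof.
move=> injI clI /continuous_closedP cil; apply/continuous_closedP => C clC.
suff -> : l @^-1` C = (fun k => i (l k)) @^-1` (i @` C) by exact: cil (clI _ clC).
by apply/seteqP; split=> k /=; [exists (l k)|case=> c Cc /injI <-].
Qed.

(** Under a probe K -> X * Y, the image of C pulls back into the closed subset
    K' on which the two components lie in the images of i and j.  On K', again compact
    Hausdorff, the probe lifts to A * B, and the preimage of C under the lift is
    closed in K', hence in K. *)
Lemma closed_kmap (A X B Y : topologicalType) (i : A -> X) (j : B -> Y) :
  injective i -> (forall C : set A, closed C -> closed (i @` C)) ->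
  injective j -> (forall C : set B, closed C -> closed (j @` C)) ->
  forall C : set (kprod A B), closed C ->
    closed ((fun p => (i p.1, j p.2) : kprod X Y) @` C).
Proof.
move=> injI clI injJ clJ C clC; rewrite -openC open_kificationE => K f cK hK cf.
rewrite preimage_setC openC.
have cf1 : continuous (fun k => (f k).1).
  exact: (continuous_compose cf (@continuous_fst _ _)).
have cf2 : continuous (fun k => (f k).2).
  exact: (continuous_compose cf (@continuous_snd _ _)).
pose K' := (fun k => (f k).1) @^-1` range i `&` (fun k => (f k).2) @^-1` range j.
have clK' : closed K'.
  apply: closedI; first by move/continuous_closedP: cf1; apply; exact/clI/closedT.
  by move/continuous_closedP: cf2; apply; exact/clJ/closedT.
have cK' : compact K' by exact: subclosed_compact clK' cK _.
have sv (k : set_type K') : K' (set_val k) by exact: set_valP.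
pose l (k : set_type K') : kprod A B :=
  (s2val (cid2 (sv k).1), s2val (cid2 (sv k).2)).
have l1 k : i (l k).1 = (f (set_val k)).1.
  exact: (s2valP' (cid2 (sv k).1)).
have l2 k : j (l k).2 = (f (set_val k)).2.
  exact: (s2valP' (cid2 (sv k).2)).
have sc : continuous (set_val : set_type K' -> K).
  exact: initial_continuous.
have cl : continuous l.
  apply: continuous_kpair.
  - by apply: cg_compact; [exact: compact_set_type|exact: hausdorff_set_type].
  - apply: (closed_injection_lift injI clI).
    rewrite (_ : (fun k => _) = (fun k => (f (set_val k)).1)); last first.
      by apply/funext => k; exact: l1.
    exact: (@continuous_compose (set_type K') K X _ _ sc cf1).
  - apply: (closed_injection_lift injJ clJ).
    rewrite (_ : (fun k => _) = (fun k => (f (set_val k)).2)); last first.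
      by apply/funext => k; exact: l2.
    exact: (@continuous_compose (set_type K') K Y _ _ sc cf2).
have : closed (l @^-1` C) by move/continuous_closedP: cl; apply.
rewrite -openC => -[V oV VE].
rewrite (_ : (fun a => _) = K' `&` ~` V).
  by apply: closedI => //; rewrite closedC.
apply/seteqP; split=> k /=.
- move=> [[a b] Cab /= fk].
  have K'k : K' k by split; rewrite /= -fk; [exists a|exists b].
  split=> // Vk.
  have : (set_val @^-1` V) (SigSub (mem_set K'k) : set_type K') by [].
  rewrite VE /=; apply; suff -> : l (SigSub (mem_set K'k)) = (a, b) by [].
  rewrite [LHS]surjective_pairing; congr pair.
  + by apply: injI; rewrite l1 -fk.
  + by apply: injJ; rewrite l2 -fk.
- move=> [K'k nVk]; exists (l (SigSub (mem_set K'k))).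
    apply: contrapT => nC.
    have : (~` (l @^-1` C)) (SigSub (mem_set K'k) : set_type K') by [].
    by rewrite -VE.
  by rewrite [RHS]surjective_pairing l1 l2.
Qed.

(** The tube lemma, valid for the compactly generated product because it may be
    tested on L * K for probes L of Y, and L * K is compact Hausdorff. *)
Lemma kprod_tube (Y K : topologicalType) (N : set K) (P : set (kprod Y K)) :
  compactly_generated Y -> compact [set: K] -> hausdorff_space K -> closed N ->
  open P -> open [set y | forall k, N k -> P (y, k)].
Proof.
move=> cgY cK hK clN oP; apply: cgY => L l cL hL cl.
have cN : compact N by exact: subclosed_compact clN cK _.
have cLK : continuous (fun q : L * K => (l q.1, q.2) : kprod Y K).
  apply: continuous_kpair.
  - by apply: cg_compact; [exact: compact_pair|exact: hausdorff_pair].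
  - exact: (continuous_compose (@continuous_fst _ _)).
  - exact: continuous_snd.
have oP' : open [set q : L * K | P (l q.1, q.2)].
  by move/continuousP: cLK; apply.
rewrite openE /= => x Px; rewrite /interior /=.
have /compact_near_coveringP/near_covering_withinP := cN.
move=> /(_ L (nbhs x) (fun x' k => P (l x', k)) _); apply.
 move=> k Nk.
  have : nbhs (x, k) [set q : L * K | P (l q.1, q.2)].
    by apply: open_nbhs_nbhs; split=> //=; exact: Px.
  case=> -[U V] [/= nU nV] UV; exists (V, U) => // -[k' x'] [/= Vk Ux] _.
  exact: (UV (x', k')).
Qed.

(** Multiplying a quotient map with an identity gives a quotient map.  Here the
    quotient map is a jointly surjective family of maps q n, so that the
    statement applies to collapses as well as to the James construction.
    Near a point k0 of a probe K, choose a closed neighbourhood N on which the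
    condition holds with the first coordinate fixed; the set U of first
    coordinates that are good for all of N pulls back to open sets by the tube
    lemma, hence is open, and N and U together give a neighbourhood of k0. *)
Lemma kprod_quotient_continuous (I : Type) (Y : I -> topologicalType)
    (Z C W : topologicalType) (q : forall n, Y n -> Z) (F : kprod Z C -> W) :
  (forall n, compactly_generated (Y n)) ->
  (forall z, exists n y, q n y = z) ->
  (forall U : set Z, (forall n, open (q n @^-1` U)) -> open U) ->
  (forall n, continuous (fun p : kprod (Y n) C => F (q n p.1, p.2))) ->
  continuous F.
Proof.
move=> cgY sq oq cF; apply/continuousP => V oV.
rewrite open_kificationE => K f cK hK cf.
have cf1 : continuous (fun k => (f k).1).
  exact: (continuous_compose cf (@continuous_fst _ _)).
have cf2 : continuous (fun k => (f k).2).
  exact: (continuous_compose cf (@continuous_snd _ _)).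
have oG n : open [set p : kprod (Y n) K | V (F (q n p.1, (f p.2).2))].
  have cid : continuous (idfun : Y n -> Y n) by move=> x.
  have /continuousP := continuous_compose (continuous_kmap cid cf2) (cF n).
  by apply.
rewrite openE => k0 /= Vk0; rewrite /interior /=.
have [n [y0 qy0]] := sq (f k0).1.
have nO : nbhs k0 [set k | V (F ((f k0).1, (f k).2))].
  apply: open_nbhs_nbhs; split; last by rewrite /= -surjective_pairing.
  rewrite -qy0.
  have /continuousP : continuous (fun k => (y0, k) : kprod (Y n) K).
    apply: continuous_kpair; [exact: cg_compact|by move=> x; exact: cvg_cst|].
    by move=> x.
  by move/(_ _ (oG n)).
(* Points of a compact Hausdorff space have closed neighbourhood bases. *)
have [N nN NO] : filter_from (nbhs k0) closure
    [set k | V (F ((f k0).1, (f k).2))].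
  by apply: (@compact_regular K k0 setT hK cK) => //; exact: filterT.
pose U := [set z | forall k, closure N k -> V (F (z, (f k).2))].
have oU : open U.
  apply: oq => m.
  exact: (kprod_tube (cgY m) cK hK (@closed_closure _ N) (oG m)).
have nU : nbhs k0 [set k | U (f k).1].
  by apply: cf1; apply: open_nbhs_nbhs; split=> // k /NO.
near=> k.
have : U (f k).1 by near: k; exact: nU.
move=> /(_ k); rewrite /= -surjective_pairing; apply.
by apply: subset_closure; near: k.
Unshelve. all: by end_near.
Qed.

(** * Collapses, smash products and the suspension coordinate *)

Section collapse_theory.
Context (T : topologicalType) (S : set T).

Lemma open_collapseE (U : set (collapse S)) :
  open U = open (collapse_pi S @^-1` U).
Proof. by []. Qed.

Lemma collapse_reprK (q : collapse S) : collapse_pi S (collapse_repr q) = q.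
Proof. exact: reprK. Qed.

Lemma collapse_pi_eqP (a b : T) :
  collapse_pi S a = collapse_pi S b <-> a = b \/ (S a /\ S b).
Proof.
split.
  move/eqquotP => /= /orP[/eqP|/andP[/set_mem Sa /set_mem Sb]]; first by left.
  by right.
move=> h; apply/eqquotP; rewrite /= /collapse_rel /=.
by case: h => [->|[/mem_set -> /mem_set ->]]; rewrite ?eqxx ?orbT.
Qed.

(** A function that is constant on the collapsed set may be evaluated on any
    representative; all maps out of suspensions and smash products are computed
    with this. *)
Lemma collapse_reprE (Z : Type) (f : T -> Z) (a : T) :
  (forall b c, S b -> S c -> f b = f c) ->
  f (collapse_repr (collapse_pi S a)) = f a.
Proof.
move=> fS.
have /collapse_pi_eqP[->//|[]] := collapse_reprK (collapse_pi S a).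
exact: fS.
Qed.

Lemma continuous_collapse_pi : continuous (collapse_pi S).
Proof. by apply/continuousP. Qed.

Lemma continuous_collapse (Z : topologicalType) (f : T -> Z) :
  continuous f -> (forall b c, S b -> S c -> f b = f c) ->
  continuous (fun q : collapse S => f (collapse_repr q)).
Proof.
move=> /continuousP cf fS; apply/continuousP => U oU.
rewrite open_collapseE.
rewrite (_ : _ @^-1` _ = f @^-1` U); first exact: cf.
by apply/seteqP; split=> x /=; rewrite collapse_reprE.
Qed.

Lemma cg_collapse : compactly_generated T -> compactly_generated (collapse S).
Proof.
move=> cgT U oU; rewrite open_collapseE; apply: cgT => K k cK hK ck.
apply: (oU K (fun x => collapse_pi S (k x))) => //.
exact: (continuous_compose ck continuous_collapse_pi).
Qed.

Lemma closed_collapseE (C : set (collapse S)) :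
  closed C <-> closed (collapse_pi S @^-1` C).
Proof. by rewrite -!openC. Qed.

Lemma kcollapse_continuous (C W : topologicalType)
    (F : kprod (collapse S) C -> W) :
  compactly_generated T ->
  continuous (fun p : kprod T C => F (collapse_pi S p.1, p.2)) -> continuous F.
Proof.
move=> cgT cF.
apply: (@kprod_quotient_continuous unit (fun=> T) _ _ _ (fun=> collapse_pi S)).
- by [].
- by move=> z; exists tt, (collapse_repr z); exact: collapse_reprK.
- by move=> U; exact.
- by [].
Qed.

End collapse_theory.

Section points.
Context (R : realType).
Implicit Types X Y : ptopologicalType.

Lemma smash_pi_pointl X Y (y : Y) : smash_pi (point : X) y = point.
Proof. by apply/collapse_pi_eqP; right; split; left. Qed.

Lemma smash_pi_pointr X Y (x : X) : smash_pi x (point : Y) = point.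
Proof. by apply/collapse_pi_eqP; right; split; [right|left]. Qed.

Lemma susp_pi_point X (t : unit_interval R) : susp_pi (point : X) t = point.
Proof. by apply/collapse_pi_eqP; right; split; [apply: Or31|apply: Or31]. Qed.

Lemma susp_pi_unit0 X (x : X) : susp_pi x (unit0 R) = point.
Proof. by apply/collapse_pi_eqP; right; split; [apply: Or32|apply: Or31]. Qed.

Lemma susp_pi_unit1 X (x : X) : susp_pi x (unit1 R) = point.
Proof. by apply/collapse_pi_eqP; right; split; [apply: Or33|apply: Or31]. Qed.

Lemma susp_base_const X (Z : Type) (f : kprod X (unit_interval R) -> Z)
    (z : Z) :
  (forall t, f (point, t) = z) -> (forall x, f (x, unit0 R) = z) ->
  (forall x, f (x, unit1 R) = z) ->
  forall b c, @susp_base R X b -> @susp_base R X c -> f b = f c.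
Proof.
move=> fp f0 f1.
have h b : @susp_base R X b -> f b = z by case: b => x t [] /= ->.
by move=> b c /h -> /h ->.
Qed.

Lemma smash_base_const X Y (Z : Type) (f : kprod X Y -> Z) (z : Z) :
  (forall y, f (point, y) = z) -> (forall x, f (x, point) = z) ->
  forall b c, @smash_base X Y b -> @smash_base X Y c -> f b = f c.
Proof.
move=> fl fr.
have h b : @smash_base X Y b -> f b = z by case: b => x y [] /= ->.
by move=> b c /h -> /h ->.
Qed.

Lemma susp_reprE X (Z : Type) (f : kprod X (unit_interval R) -> Z) (z : Z)
    x t :
  (forall t, f (point, t) = z) -> (forall x, f (x, unit0 R) = z) ->
  (forall x, f (x, unit1 R) = z) ->
  f (collapse_repr (susp_pi x t)) = f (x, t).
Proof. by move=> *; apply: collapse_reprE; apply: susp_base_const. Qed.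

Lemma smash_reprE X Y (Z : Type) (f : kprod X Y -> Z) (z : Z) x y :
  (forall y, f (point, y) = z) -> (forall x, f (x, point) = z) ->
  f (collapse_repr (smash_pi x y)) = f (x, y).
Proof. by move=> *; apply: collapse_reprE; apply: smash_base_const. Qed.

Lemma continuous_susp_pi (S : topologicalType) X (f : S -> X)
    (g : S -> unit_interval R) :
  compactly_generated S -> continuous f -> continuous g ->
  continuous (fun s => susp_pi (f s) (g s)).
Proof.
move=> cgS cf cg; apply: (continuous_compose (continuous_kpair cgS cf cg)).
exact: continuous_collapse_pi.
Qed.

Lemma continuous_smash_pi (S : topologicalType) X Y (f : S -> X) (g : S -> Y) :
  compactly_generated S -> continuous f -> continuous g ->
  continuous (fun s => smash_pi (f s) (g s)).
Proof.
move=> cgS cf cg; apply: (continuous_compose (continuous_kpair cgS cf cg)).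
exact: continuous_collapse_pi.
Qed.

Lemma cg_Smash X Y : compactly_generated (Smash X Y).
Proof. by apply: cg_collapse; exact: cg_kification. Qed.

Lemma susp_mapE X Y (f : X -> Y) (x : X) (t : unit_interval R) :
  f point = point -> susp_map f (susp_pi x t) = susp_pi (f x) t.
Proof.
move=> fp; rewrite /susp_map.
have -> (p : kprod X (unit_interval R)) :
    (let: (x0, t0) := p in susp_pi (f x0) t0) = susp_pi (f p.1) p.2 by case: p.
apply: (@susp_reprE _ _ (fun p => susp_pi (f p.1) p.2) point)
  => [t'|x'|x'] /=.
- by rewrite fp susp_pi_point.
- exact: susp_pi_unit0.
- exact: susp_pi_unit1.
Qed.

Lemma susp_map_point X Y (f : X -> Y) :
  f point = point -> @susp_map R X Y f point = point.
Proof.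
move=> fp; transitivity (susp_map f (susp_pi point (unit0 R))).
  by rewrite susp_pi_point.
by rewrite susp_mapE // susp_pi_unit0.
Qed.

Lemma smash_mapE X X1 Y Y1 (f : X -> X1) (g : Y -> Y1) (x : X) (y : Y) :
  f point = point -> g point = point ->
  smash_map f g (smash_pi x y) = smash_pi (f x) (g y).
Proof.
move=> fp gp; rewrite /smash_map.
have -> (p : kprod X Y) :
    (let: (x0, t0) := p in smash_pi (f x0) (g t0)) = smash_pi (f p.1) (g p.2).
  by case: p.
apply: (@smash_reprE _ _ _ (fun p => smash_pi (f p.1) (g p.2)) point)
  => [y'|x'] /=.
- by rewrite fp smash_pi_pointl.
- by rewrite gp smash_pi_pointr.
Qed.

Lemma continuous_smash_map X X1 Y Y1 (f : X -> X1) (g : Y -> Y1) :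
  continuous f -> f point = point -> continuous g -> g point = point ->
  continuous (smash_map f g).
Proof.
move=> cf fp cg gp.
pose F (p : kprod X Y) := smash_pi (f p.1) (g p.2).
rewrite (_ : smash_map f g = fun q => F (collapse_repr q)); last first.
  by apply/funext => q; rewrite /smash_map /F; case: (collapse_repr q).
apply: (@continuous_collapse _ _ _ F).
  apply: continuous_smash_pi; first exact: cg_kification.
  - exact: (continuous_compose (@continuous_kfst X Y) cf).
  - exact: (continuous_compose (@continuous_ksnd X Y) cg).
apply: (smash_base_const (z := point)) => [y'|x'] /=.
- by rewrite /F /= fp smash_pi_pointl.
- by rewrite /F /= gp smash_pi_pointr.
Qed.

Lemma susp_piP X (q : Susp R X) : exists x t, q = susp_pi x t.
Proof.
exists (collapse_repr q).1, (collapse_repr q).2.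
by rewrite /susp_pi -surjective_pairing collapse_reprK.
Qed.

Section shift.
Context (X' C : ptopologicalType).
Local Notation I := (unit_interval R).

Let toright (p : kprod (Susp R X') C) : Smash X' (Susp R C) :=
  smash_pi (collapse_repr p.1).1 (susp_pi p.2 (collapse_repr p.1).2).

Let torightE x t c : toright (susp_pi x t, c) = smash_pi x (susp_pi c t).
Proof.
apply: (@susp_reprE _ _ (fun p => smash_pi p.1 (susp_pi c p.2)) point)
  => [t'|x'|x'] /=.
- by rewrite smash_pi_pointl.
- by rewrite susp_pi_unit0 smash_pi_pointr.
- by rewrite susp_pi_unit1 smash_pi_pointr.
Qed.

Let toright_const b c :
  @smash_base (Susp R X') C b -> @smash_base (Susp R X') C c ->
  toright b = toright c.
Proof.
apply: (smash_base_const (z := point)) => [y|q].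
- by rewrite -(susp_pi_point X' (unit0 R)) torightE smash_pi_pointl.
- have [x [t ->]] := susp_piP q.
  by rewrite torightE susp_pi_point smash_pi_pointr.
Qed.

Let susp_right_toright q : @susp_right R X' C q = toright (collapse_repr q).
Proof.
rewrite /susp_right /toright; case: (collapse_repr q) => z c /=.
by case: (collapse_repr z).
Qed.

Lemma susp_rightE x t c :
  susp_right (smash_pi (susp_pi x t) c) = smash_pi x (susp_pi c t)
    :> Smash X' (Susp R C).
Proof.
by rewrite susp_right_toright (collapse_reprE _ toright_const) torightE.
Qed.

(** Continuity has to be checked on the product of Susp X' with C, which by
    [kcollapse_continuous] is a quotient of (X' * I) * C. *)
Lemma continuous_susp_right : continuous (@susp_right R X' C).
Proof.
rewrite (_ : @susp_right R X' C = fun q => toright (collapse_repr q)); last first.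
  by apply/funext.
apply: (@continuous_collapse _ _ _ toright) toright_const.
apply: kcollapse_continuous; first exact: cg_kification.
rewrite (_ : (fun p => _) =
    fun p : kprod (kprod X' I) C => smash_pi p.1.1 (susp_pi p.2 p.1.2)).
  have c1 := @continuous_kfst (kprod X' I) C.
  have cgp := @cg_kification ((kprod X' I) * C)%type.
  apply: continuous_smash_pi => //.
    exact: (continuous_compose c1 (@continuous_kfst X' I)).
  apply: continuous_susp_pi => //; first exact: continuous_ksnd.
  exact: (continuous_compose c1 (@continuous_ksnd X' I)).
by apply/funext => -[[x t] c]; rewrite -torightE.
Qed.

Let toleft (p : kprod X' (Susp R C)) : Smash (Susp R X') C :=
  smash_pi (susp_pi p.1 (collapse_repr p.2).2) (collapse_repr p.2).1.

Let toleftE x t c : toleft (x, susp_pi c t) = smash_pi (susp_pi x t) c.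
Proof.
apply: (@susp_reprE _ _ (fun p => smash_pi (susp_pi x p.2) p.1) point)
  => [t'|x'|x'] /=.
- by rewrite smash_pi_pointr.
- by rewrite susp_pi_unit0 smash_pi_pointl.
- by rewrite susp_pi_unit1 smash_pi_pointl.
Qed.

Let toleft_const b c :
  @smash_base X' (Susp R C) b -> @smash_base X' (Susp R C) c ->
  toleft b = toleft c.
Proof.
apply: (smash_base_const (z := point)) => [q|y].
- have [x [t ->]] := susp_piP q.
  by rewrite toleftE susp_pi_point smash_pi_pointl.
- by rewrite -(susp_pi_point C (unit0 R)) toleftE smash_pi_pointr.
Qed.

Let susp_left_toleft q : @susp_left R X' C q = toleft (collapse_repr q).
Proof.
rewrite /susp_left /toleft; case: (collapse_repr q) => z c /=.
by case: (collapse_repr c).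
Qed.

Lemma susp_leftE x t c :
  susp_left (smash_pi x (susp_pi c t)) = smash_pi (susp_pi x t) c
    :> Smash (Susp R X') C.
Proof.
by rewrite susp_left_toleft (collapse_reprE _ toleft_const) toleftE.
Qed.

Lemma continuous_susp_left : continuous (@susp_left R X' C).
Proof.
rewrite (_ : @susp_left R X' C = fun q => toleft (collapse_repr q)); last first.
  by apply/funext.
apply: (@continuous_collapse _ _ _ toleft) toleft_const.
(* The factors are exchanged to make the quotient the first one. *)
have csw : continuous (fun p : kprod (Susp R C) X' => toleft (p.2, p.1)).
  apply: kcollapse_continuous; first exact: cg_kification.
  rewrite (_ : (fun p => _) =
      fun p : kprod (kprod C I) X' => smash_pi (susp_pi p.2 p.1.2) p.1.1).
    have c1 := @continuous_kfst (kprod C I) X'.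
    have cgp := @cg_kification ((kprod C I) * X')%type.
    apply: continuous_smash_pi => //; last first.
      exact: (continuous_compose c1 (@continuous_kfst C I)).
    apply: continuous_susp_pi => //; first exact: continuous_ksnd.
    exact: (continuous_compose c1 (@continuous_ksnd C I)).
  by apply/funext => -[[c t] x]; rewrite -toleftE.
rewrite (_ : toleft = fun p => toleft ((p.2, p.1).2, (p.2, p.1).1)); last first.
  by apply/funext => -[].
apply: (@continuous_compose _ _ _ (fun p : kprod X' (Susp R C) =>
  (p.2, p.1) : kprod (Susp R C) X') _ _ csw).
apply: continuous_kpair; first exact: cg_kification.
- exact: continuous_ksnd.
- exact: continuous_kfst.
Qed.

End shift.

End points.

(** * Moore loops and the map alpha *)

Section james_theory.
Context (Y : ptopologicalType).

Lemma open_jamesE (U : set (James Y)) :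
  open U = (forall n, open [set v : kpow Y n | U (reduce (letters v))]).
Proof. by []. Qed.

Lemma cg_kpow n : compactly_generated Y -> compactly_generated (kpow Y n).
Proof.
move=> cgY; case: n => [|n]; last exact: cg_kification.
by move=> U _; exact: discrete_open.
Qed.

Lemma letters_surj (s : seq Y) : exists n (v : kpow Y n), letters v = s.
Proof.
elim: s => [|y s [n [v vs]]]; first by exists 0%N, tt.
by exists n.+1, (y, v); rewrite /= vs.
Qed.

Lemma word_reduce (s : seq Y) : word (reduce s) = [seq y <- s | y != point].
Proof. by []. Qed.

Lemma reduce_word (w : James Y) : reduce (word w) = w.
Proof.
case: w => w pw; apply: val_inj => /=; apply/all_filterP/allP => y yw.
by apply: contraNneq pw => <-.
Qed.

Lemma reduce_surj (w : James Y) : exists n (v : kpow Y n), reduce (letters v) = w.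
Proof.
have [n [v vE]] := letters_surj (word w).
by exists n, v; rewrite vE reduce_word.
Qed.

Lemma continuous_reduce n : continuous (fun v : kpow Y n => reduce (letters v)).
Proof. by apply/continuousP => U; rewrite open_jamesE; apply. Qed.

(** James Y is a quotient of the family of powers of Y, so maps out of a product
    with James Y may be tested on these powers. *)
Lemma kjames_continuous (C W : topologicalType) (F : kprod (James Y) C -> W) :
  compactly_generated Y ->
  (forall n, continuous (fun p : kprod (kpow Y n) C =>
     F (reduce (letters p.1), p.2))) -> continuous F.
Proof.
move=> cgY cF.
apply: (@kprod_quotient_continuous nat (kpow Y) _ _ _
  (fun n v => reduce (letters v))) => //.
- by move=> n; exact: cg_kpow.
- exact: reduce_surj.
Qed.

End james_theory.

Lemma continuous_to_set_type (S T : topologicalType) (C : set T)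
    (f : S -> set_type C) :
  continuous (fun s => set_val (f s)) -> continuous f.
Proof.
move=> /continuousP cf; apply/continuousP => _ [V oV <-].
exact: cf.
Qed.

Lemma continuous_paste (R : realType) (S T : topologicalType) (d e : S -> R)
    (f g : S -> T) :
  continuous d -> continuous e -> continuous f -> continuous g ->
  (forall s, d s = e s -> f s = g s) ->
  continuous (fun s => if d s <= e s then f s else g s).
Proof.
move=> cd ce /continuous_closedP cf /continuous_closedP cg fg.
have cle (d' e' : S -> R) : continuous d' -> continuous e' ->
    closed [set s | d' s <= e' s].
  move=> cd' ce'.
  rewrite (_ : [set _ | _] = (fun s => e' s - d' s) @^-1` [set x | 0 <= x]).
    have cB : continuous (fun s => e' s - d' s).
      by move=> s; apply: cvgB; [exact: ce'|exact: cd'].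
    by move/continuous_closedP: cB; apply; exact: closed_ge.
  by apply/seteqP; split=> s /=; rewrite subr_ge0.
apply/continuous_closedP => C clC.
rewrite (_ : _ @^-1` _ = ([set s | d s <= e s] `&` f @^-1` C) `|`
                         ([set s | e s <= d s] `&` g @^-1` C)).
  by apply: closedU; apply: closedI; [exact: cle|exact: cf|exact: cle|exact: cg].
apply/seteqP; split=> s /=.
  by case: (leP (d s) (e s)) => h Cs; [left|right; split=> //; exact: ltW].
case: (leP (d s) (e s)) => h [[h1 Cs]|[h1 Cs]] //.
by rewrite fg //; apply/eqP; rewrite eq_le h h1.
Qed.

Section moore.
Context (R : realType).
Local Notation I := (unit_interval R).

Lemma unit_interval_compact : compact [set: I].
Proof. exact: (compact_set_type (@segment_compact R 0 1)). Qed.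

Lemma unit_interval_hausdorff : hausdorff_space I.
Proof. exact: (hausdorff_set_type (@norm_hausdorff R R)). Qed.

Lemma uval_to_unit (s : R) : 0 <= s <= 1 -> uval (to_unit s) = s.
Proof.
by move=> s01; apply: insubdK; apply: mem_set; rewrite /= in_itv.
Qed.

Lemma to_unit_le0 (s : R) : s <= 0 -> to_unit s = unit0 R.
Proof.
rewrite le_eqVlt => /orP[/eqP ->|s0].
  by apply: val_inj; apply: (uval_to_unit (s := 0)); rewrite lexx ler01.
rewrite /to_unit /insubd insubF //; apply/negP => /set_mem /=.
by rewrite in_itv /= leNgt s0.
Qed.

Lemma to_unit1 : to_unit 1 = unit1 R.
Proof. by apply: val_inj; apply: (uval_to_unit (s := 1)); rewrite ler01 lexx. Qed.

Lemma continuous_uval : continuous (@uval R).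
Proof. exact: initial_continuous. Qed.

(** Unlike [to_unit], which jumps back to 0 after 1, this is continuous. *)
Definition clamp (s : R) : I := to_unit (Num.min 1 s).

Lemma continuous_clamp : continuous clamp.
Proof.
apply: continuous_to_set_type.
rewrite (_ : (fun s => _) = fun s : R => Num.max 0 (Num.min 1 s)).
  move=> s; apply: (@continuous_max R R (fun=> 0)); first exact: cvg_cst.
  by apply: (@continuous_min R R (fun=> 1)); first exact: cvg_cst.
apply/funext => s; rewrite /clamp.
have [s0|s0] := leP s 0.
  have s1 : s <= 1 by exact: le_trans s0 ler01.
  by rewrite (min_idPr s1) (max_idPl s0) to_unit_le0.
rewrite (max_idPr _); last by rewrite le_min ler01 ltW.
by apply: uval_to_unit; rewrite le_min ler01 (ltW s0) ge_min lexx.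
Qed.

Context (B : ptopologicalType) (u : B -> R).
Hypotheses (cgB : compactly_generated B) (lu : letter_length u).

Let cu : continuous u. Proof. by case: lu. Qed.
Let u_ge0 b : 0 <= u b. Proof. by case: lu. Qed.
Let u_eq0 b : u b = 0 <-> b = point. Proof. by case: lu. Qed.

(** Where u(b) is positive, the denominator may be replaced by max(e, u(b)) with
    e > 0, which never vanishes.  Where u(b) = 0, i.e. b is the basepoint, the
    quotient s / u(b) has no limit, but its value is irrelevant: by the tube
    lemma every neighbourhood of the basepoint of Susp B contains the whole
    interval over each point of B near the basepoint. *)
Lemma continuous_letter_path (S : topologicalType) (b : S -> B) (s : S -> R) :
  compactly_generated S -> continuous b -> continuous s ->
  continuous (fun k => susp_pi (b k) (clamp (s k / u (b k)))).
Proof.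
move=> cgS cb cs k0; have [u0|u_neq0] := eqVneq (u (b k0)) 0.
  have b0 := (u_eq0 _).1 u0.
  move=> V; rewrite {1}b0 susp_pi_point nbhsE => -[W [oW W0] WV].
  have oP : open [set p : kprod B I | W (susp_pi p.1 p.2)].
    have /continuousP := continuous_susp_pi (@cg_kification (B * I)%type)
      (@continuous_kfst B I) (@continuous_ksnd B I).
    by apply.
  have := kprod_tube (N := setT) cgB unit_interval_compact unit_interval_hausdorff
    closedT oP.
  set U := [set y | _] => oU.
  have nU : nbhs k0 [set k | U (b k)].
    apply: cb; apply: open_nbhs_nbhs; split=> // t _ /=.
    by rewrite b0 susp_pi_point.
  by apply: filterS nU => k Uk; apply: WV; exact: Uk.
(* Half of the value at k0, so that e < u (b k) holds near k0. *)
pose e := u (b k0) / 2.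
have e_gt0 : 0 < e by rewrite divr_gt0 // lt_def u_neq0 u_ge0.
pose g k := susp_pi (b k) (clamp (s k / Num.max e (u (b k)))).
have cub : continuous (fun k => u (b k)) by exact: continuous_compose.
have cg : continuous g.
  apply: continuous_susp_pi => //; apply: continuous_compose continuous_clamp.
  move=> k; apply: cvgM; first exact: cs.
  apply: cvgV; first by rewrite gt_eqF // lt_max e_gt0.
  by apply: (@continuous_max R S (fun=> e)); [exact: cvg_cst|exact: cub].
have near_g : \forall k \near k0,
    susp_pi (b k) (clamp (s k / u (b k))) = g k.
  have : \forall k \near k0, e < u (b k).
    apply: (cvgr_gt (u (b k0)) (cub k0)).
    by rewrite /e ltr_pdivrMr // mulr_natr mulr2n ltrDl lt_def u_neq0 u_ge0.
  by apply: filterS => k ek; rewrite /g (max_idPr _) // ltW.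
have gk0 : susp_pi (b k0) (clamp (s k0 / u (b k0))) = g k0.
  exact: nbhs_singleton near_g.
rewrite /continuous_at gk0.
apply: cvg_trans (cg k0); apply: near_eq_cvg.
by apply: filterS near_g => k ->.
Qed.

Lemma moore_loop_le0 (w : seq B) (s : R) : s <= 0 -> moore_loop u w s = point.
Proof.
move=> s0; case: w => [|b w] //=; rewrite (le_trans s0 (u_ge0 b)).
by rewrite to_unit_le0 ?susp_pi_unit0 // mulr_le0_ge0 // invr_ge0.
Qed.

(** Letters equal to the basepoint have length 0 and do not change the loop;
    this makes the loop of a reduced word continuous in the unreduced one. *)
Lemma moore_loop_filter (w : seq B) (s : R) :
  moore_loop u [seq b <- w | b != point] s = moore_loop u w s.
Proof.
elim: w s => [|b w IH] s //=; have [->|b_neq0] := eqVneq b point => /=.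
  rewrite IH (u_eq0 _).2 // subr0 susp_pi_point.
  by case: leP => // s0; rewrite moore_loop_le0.
by rewrite IH.
Qed.

Lemma moore_loop_end (w : seq B) : moore_loop u w (\sum_(b <- w) u b) = point.
Proof.
elim: w => [|b w IH]; first by rewrite big_nil.
rewrite big_cons /=; set t := \sum_(_ <- _) _ in IH *.
have t0 : 0 <= t by apply: sumr_ge0.
case: leP => h; last by rewrite addrC addKr // addrC.
have -> : t = 0 by apply/eqP; rewrite eq_le t0 andbT -(lerD2l (u b)) addr0.
rewrite addr0; have [ub0|ub_neq0] := eqVneq (u b) 0.
  by rewrite ((u_eq0 _).1 ub0) susp_pi_point.
by rewrite divff // to_unit1 susp_pi_unit1.
Qed.

(** The loop of b :: w is pasted from the path of b on s <= u(b) and the loop of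
    w on s >= u(b); the two agree for s = u(b), where both are at the
    basepoint. *)
Lemma continuous_moore_loop (S : topologicalType) n (v : S -> kpow B n)
    (s : S -> R) :
  compactly_generated S -> continuous v -> continuous s ->
  continuous (fun k => moore_loop u (letters (v k)) (s k)).
Proof.
move=> cgS; elim: n v s => [|n IH] v s cv cs; first by move=> k; exact: cvg_cst.
have cb : continuous (fun k => (v k).1).
  exact: (continuous_compose cv (@continuous_kfst B (kpow B n))).
have cv' : continuous (fun k => (v k).2).
  exact: (continuous_compose cv (@continuous_ksnd B (kpow B n))).
have cub : continuous (fun k => u (v k).1) by exact: continuous_compose.
rewrite (_ : (fun k => _) = fun k => if s k <= u (v k).1
    then susp_pi (v k).1 (clamp (s k / u (v k).1))
    else moore_loop u (letters (v k).2) (s k - u (v k).1)).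
  apply: continuous_paste => //.
  - exact: continuous_letter_path.
  - apply: IH => // k; apply: cvgB; [exact: cs|exact: cub].
  - move=> k ->; rewrite subrr moore_loop_le0 //.
    have [ub0|ub_neq0] := eqVneq (u (v k).1) 0.
      by rewrite ((u_eq0 _).1 ub0) susp_pi_point.
    by rewrite divff // /clamp minxx to_unit1 susp_pi_unit1.
apply/funext => k /=; case: leP => // h; rewrite /clamp (min_idPr _) //.
have [->|ub_neq0] := eqVneq (u (v k).1) 0; first by rewrite invr0 mulr0 ler01.
by rewrite ler_pdivrMr ?mul1r // lt_def ub_neq0 u_ge0.
Qed.

Lemma continuous_james_map :
  continuous (fun p : kprod (James B) I => james_map u p.1 p.2).
Proof.
apply: kjames_continuous => // n /=.
pose L (p : kprod (kpow B n) I) := uval p.2 * \sum_(b <- letters p.1) u b.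
rewrite (_ : (fun p => _) =
    fun p : kprod (kpow B n) I => moore_loop u (letters p.1) (L p)).
  apply: continuous_moore_loop; first exact: cg_kification.
    exact: continuous_kfst.
  have cL m : continuous (fun v : kpow B m => \sum_(b <- letters v) u b).
    elim: m => [|m IH] /=.
      by move=> v; exact: cvg_cst.
    rewrite (_ : (fun v => _) = fun v : kprod B (kpow B m) =>
        u v.1 + \sum_(b <- letters v.2) u b).
      have c1 := continuous_compose (@continuous_kfst B (kpow B m)) cu.
      have c2 := continuous_compose (@continuous_ksnd B (kpow B m)) IH.
      by move=> v; exact: (cvgD (c1 v) (c2 v)).
    by apply/funext => v; rewrite big_cons.
  have c1 := continuous_compose (@continuous_ksnd (kpow B n) I) continuous_uval.
  have c2 := continuous_compose (@continuous_kfst (kpow B n) I) (cL n).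
  by move=> p; exact: (cvgM (c1 p) (c2 p)).
apply/funext => p /=; rewrite /james_map word_reduce moore_loop_filter.
congr (moore_loop _ _ (_ * _)); rewrite big_filter big_mkcond /=.
by apply: eq_bigr => b _; case: eqVneq => // ->; rewrite (u_eq0 _).2.
Qed.

Lemma james_map_const :
  [/\ forall t, james_map u point t = point,
      forall w, james_map u w (unit0 R) = point &
      forall w, james_map u w (unit1 R) = point].
Proof.
split=> [t|w|w]; rewrite /james_map.
- by [].
- by rewrite mul0r moore_loop_le0.
- by rewrite mul1r moore_loop_end.
Qed.

Lemma james_retractionE w t : james_retraction u (susp_pi w t) = james_map u w t.
Proof.
have [jp j0 j1] := james_map_const.
rewrite /james_retraction.
pose F (p : kprod (James B) I) := james_map u p.1 p.2.
transitivity (F (collapse_repr (susp_pi w t))).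
  by rewrite /F; case: (collapse_repr _).
exact: (@susp_reprE _ _ _ F point).
Qed.

Lemma continuous_james_retraction : continuous (james_retraction u).
Proof.
have [jp j0 j1] := james_map_const.
pose F (p : kprod (James B) I) := james_map u p.1 p.2.
rewrite (_ : james_retraction u = fun q => F (collapse_repr q)); last first.
  by apply/funext => q; rewrite /james_retraction /F; case: (collapse_repr _).
apply: (@continuous_collapse _ _ _ F); first exact: continuous_james_map.
exact: (susp_base_const (z := point)).
Qed.

Lemma james_retraction_point : james_retraction u point = point.
Proof.
have [jp _ _] := james_map_const.
by rewrite -(susp_pi_point _ (unit0 R)) james_retractionE jp.
Qed.

Lemma continuous_alpha X' : continuous (@alpha R X' B u).
Proof.
apply: continuous_compose (@continuous_susp_left R X' B).
apply: continuous_compose (@continuous_susp_right R X' (James B)) _.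
apply: continuous_smash_map => //.
- by move=> x.
- exact: continuous_james_retraction.
- exact: james_retraction_point.
Qed.

Lemma alphaE (X' : ptopologicalType) (x : X') t w :
  alpha u (smash_pi (susp_pi x t) w) = susp_left (smash_pi x (james_map u w t)).
Proof.
rewrite /alpha /= susp_rightE smash_mapE ?james_retractionE //.
Qed.

Lemma alpha_pointl (X' : ptopologicalType) w :
  alpha u (smash_pi (point : Susp R X') w) = point.
Proof.
rewrite -(susp_pi_point X' (unit0 R)) alphaE smash_pi_pointl.
by rewrite -(smash_pi_pointl X' (susp_pi (point : B) (unit0 R))) susp_leftE
  susp_pi_point smash_pi_pointl.
Qed.

(** The map alpha moves only the suspension coordinate and the second factor, so
    it commutes with maps of the desuspended first factor. *)
Lemma alpha_natural (X' A' : ptopologicalType) (i' : A' -> X') (a : Susp R A') w :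
  i' point = point ->
  alpha u (smash_pi (susp_map i' a) w) =
  smash_map (susp_map i') idfun (alpha u (smash_pi a w)).
Proof.
move=> ip; have [x [t ->]] := susp_piP a; rewrite susp_mapE // !alphaE.
have [b [s ->]] := susp_piP (james_map u w t).
by rewrite !susp_leftE smash_mapE ?susp_map_point // susp_mapE.
Qed.

End moore.

(** * Closed inclusions of suspensions *)

(** A point is the image of a constant probe. *)
Lemma weak_hausdorff_closed1 (X : topologicalType) (x : X) :
  weak_hausdorff X -> closed [set x].
Proof.
move=> whX.
have := whX bool (fun=> x) bool_compact (@order_hausdorff _ bool).
rewrite (_ : range _ = [set x]).
  by apply; move=> b; exact: cvg_cst.
by apply/seteqP; split=> y /=; [case=> _ _ ->|move=> ->; exists true].
Qed.

Section susp_inclusion.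
Context (R : realType) (A X : ptopologicalType) (i : A -> X).
Hypotheses (ip : i point = point) (injI : injective i).
Hypotheses (clI : forall C : set A, closed C -> closed (i @` C)).
Hypothesis clp : closed [set (point : X)].

Lemma closed_susp_base : closed (@susp_base R X).
Proof.
have cl1 (t : unit_interval R) : closed [set t].
  apply: accessible_closed_set1; apply: hausdorff_accessible.
  exact: unit_interval_hausdorff.
have /continuous_closedP c1 := @continuous_kfst X (unit_interval R).
have /continuous_closedP c2 := @continuous_ksnd X (unit_interval R).
rewrite (_ : @susp_base R X = (fun p => p.1) @^-1` [set point] `|`
  ((fun p => p.2) @^-1` [set unit0 R] `|` (fun p => p.2) @^-1` [set unit1 R])).
  by apply: closedU; [exact: c1|apply: closedU; exact: c2].
apply/seteqP; split=> p /=.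
  by case=> ->; [left|right; left|right; right].
by case=> [h|[h|h]]; [exact: Or31|exact: Or32|exact: Or33].
Qed.

Lemma closed1_Susp : closed [set (point : Susp R X)].
Proof.
apply/closed_collapseE; rewrite (_ : _ @^-1` _ = @susp_base R X).
  exact: closed_susp_base.
apply/seteqP; split=> p /=.
  by move/collapse_pi_eqP => [->|[]//]; apply: Or31.
by move=> bp; apply/collapse_pi_eqP; right; split=> //; apply: Or31.
Qed.

Lemma susp_map_inj : injective (@susp_map R A X i).
Proof.
move=> q q'; have [a [t ->]] := susp_piP q; have [a' [t' ->]] := susp_piP q'.
rewrite !susp_mapE //; move/collapse_pi_eqP => [[/injI -> -> //]|[b b']].
have base c s : @susp_base R X (i c, s) -> @susp_base R A (c, s).
  by case=> /= [|->|->]; [rewrite -ip => /injI ->; apply: Or31|apply: Or32|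
    apply: Or33].
by apply/collapse_pi_eqP; right; split; exact: base.
Qed.

Lemma continuous_susp_map : continuous i -> continuous (@susp_map R A X i).
Proof.
move=> ci; pose F (p : kprod A (unit_interval R)) := susp_pi (i p.1) p.2.
rewrite (_ : susp_map i = fun q => F (collapse_repr q)); last first.
  by apply/funext => q; rewrite /susp_map /F; case: (collapse_repr _).
apply: (@continuous_collapse _ _ _ F).
  apply: continuous_susp_pi; first exact: cg_kification.
  - exact: (continuous_compose (@continuous_kfst A (unit_interval R)) ci).
  - exact: continuous_ksnd.
apply: (susp_base_const (z := point)) => [t|x|x]; rewrite /F /=.
- by rewrite ip susp_pi_point.
- exact: susp_pi_unit0.
- exact: susp_pi_unit1.
Qed.

(** Upstairs in X * I, the image of C is the image of a closed set of A * I,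
    together with the collapsed set when C contains the basepoint. *)
Lemma closed_susp_map (C : set (Susp R A)) :
  closed C -> closed (@susp_map R A X i @` C).
Proof.
move=> /closed_collapseE clC; apply/closed_collapseE.
pose D := [set p | @susp_base R X p /\ C point].
have clD : closed D.
  have [Cp|nCp] := pselect (C point).
    rewrite (_ : D = @susp_base R X); first exact: closed_susp_base.
    by apply/seteqP; split=> p; [case|move=> bp; split].
  rewrite (_ : D = set0); first exact: closed0.
  by apply/seteqP; split=> p; [case|].
have clid (E : set (unit_interval R)) : closed E -> closed (idfun @` E).
  by rewrite image_id.
have /(_ _ clC) clM := closed_kmap injI clI (@inj_id _) clid.
rewrite (_ : _ @^-1` _ = ((fun p : kprod A (unit_interval R) =>
    (i p.1, p.2) : kprod X (unit_interval R)) @`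
      (@collapse_pi (kprod A (unit_interval R)) (@susp_base R A) @^-1` C)) `|` D).
  exact: closedU.
apply/seteqP; split=> -[x t] /=.
  move=> [q Cq]; have [a [s qE]] := susp_piP q.
  rewrite qE susp_mapE //; move/collapse_pi_eqP => [[<- <-]|[b b']].
    by left; exists (a, s) => //=; move: Cq; rewrite qE.
  right; split=> //; suff <- : q = point by [].
  apply: susp_map_inj; rewrite qE susp_mapE // susp_map_point //.
  by apply/collapse_pi_eqP; right; split=> //; apply: Or31.
case=> [[[a s] Cas [<- <-]]|[bx Cp]].
  by exists (susp_pi a s) => //; rewrite susp_mapE.
exists point => //; rewrite susp_map_point //.
by apply/collapse_pi_eqP; right; split=> //; apply: Or31.
Qed.

End susp_inclusion.

(** * Detecting closed sets of the relative James construction *)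

Section relative.
Context (A X : ptopologicalType) (i : A -> X).
Hypotheses (ip : i point = point) (injI : injective i).
Hypotheses (clI : forall C : set A, closed C -> closed (i @` C)).
Hypothesis clp : closed [set (point : X)].

Fixpoint kpow_map (n : nat) : kpow A n -> kpow X n :=
  if n is n'.+1 then fun v => (i v.1, kpow_map v.2) else fun v => v.

Lemma letters_kpow_map n (v : kpow A n) :
  letters (kpow_map v) = [seq i a | a <- letters v].
Proof. by elim: n v => //= n IH v; rewrite IH. Qed.

Lemma kpow_map_inj n : injective (@kpow_map n).
Proof.
elim: n => [|n IH] //= [a v] [b w] /= [/injI -> /IH ->] //.
Qed.

Lemma closed_kpow_map n (C : set (kpow A n)) :
  closed C -> closed (@kpow_map n @` C).
Proof.
elim: n C => [|n IH] C clC; first exact: discrete_closed.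
exact: (closed_kmap injI clI (@kpow_map_inj n) IH).
Qed.

Lemma kpow_map_onto n (v : kpow X n) :
  (forall x, x \in letters v -> range i x) -> exists a, kpow_map a = v.
Proof.
elim: n v => [|n IH] /= v vi; first by exists v.
have [a _ av] : range i v.1 by apply: vi; rewrite mem_head.
have [b bv] : exists b, kpow_map b = v.2.
  by apply: IH => x xv; apply: vi; rewrite inE xv orbT.
by exists (a, b); rewrite /= av bv [RHS]surjective_pairing.
Qed.

Lemma reduce_point (s : seq X) : reduce (point :: s) = reduce s.
Proof. by apply: val_inj; rewrite /= eqxx. Qed.

(** The powers of X are split according to whether the first letter x is the
    basepoint.  If it is, the tail has to satisfy the same condition, which is
    closed by induction; otherwise all the other letters are in A, and the
    vectors in question are the image of a closed set under a closed
    inclusion. *)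
Lemma closed_later_letters (E : set (James X)) :
  E `<=` later_letters i ->
  (forall n, closed [set p : kprod X (kpow A n) |
     E (reduce (p.1 :: [seq i a | a <- letters p.2]))]) ->
  closed E.
Proof.
move=> Elater clE; rewrite -openC open_jamesE => n.
suff: closed [set v : kpow X n | E (reduce (letters v))] by rewrite -openC.
elim: n => [|n IH]; first exact: discrete_closed.
rewrite (_ : [set _ | _] =
    ((fun p : kprod X (kpow X n) => p.1) @^-1` [set point] `&`
     (fun p : kprod X (kpow X n) => p.2) @^-1`
       [set v | E (reduce (letters v))]) `|`
  ((fun p : kprod X (kpow A n) => (p.1, kpow_map p.2) : kprod X (kpow X n)) @`
     [set p | E (reduce (p.1 :: [seq i a | a <- letters p.2]))])).
  apply: closedU.
    apply: closedI.
    - by have /continuous_closedP := @continuous_kfst X (kpow X n); apply.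
    - by have /continuous_closedP := @continuous_ksnd X (kpow X n); apply.
  apply: (closed_kmap (i := idfun) (@inj_id _) _ (@kpow_map_inj n)
    (@closed_kpow_map n)) => //.
  by move=> C clC; rewrite image_id.
apply/seteqP; split=> -[x v] /=.
  move=> Exv; have [x0|x_neq0] := eqVneq x point.
    by left; split=> //; move: Exv; rewrite x0 reduce_point.
  right; have [y|a av] := kpow_map_onto (v := v).
    move=> yv; have [->|y_neq0] := eqVneq y point; first by exists point.
    apply: (Elater _ Exv); rewrite word_reduce /= x_neq0 /=.
    by rewrite mem_filter y_neq0.
  by exists (x, a); rewrite /= ?av // -letters_kpow_map av.
case=> [[-> Ev]|[[y a] Eya [<- <-]]]; first by rewrite reduce_point.
by rewrite letters_kpow_map.
Qed.

Lemma reduce_later (x : X) (s : seq X) :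
  (forall y, y \in s -> range i y) -> later_letters i (reduce (x :: s)).
Proof.
move=> sA y; rewrite word_reduce /=.
have h : y \in [seq z <- s | z != point] -> range i y.
  by rewrite mem_filter => /andP[_ /sA].
by case: ifP => _ /=; [exact: h|move=> /mem_behead; exact: h].
Qed.

End relative.

(** * The letterwise extension to the relative James construction *)

Section extension.
Context (A X A1 Z : ptopologicalType) (i : A -> X) (j : A1 -> Z).
Context (theta : kprod X (James A) -> Z).
Hypotheses (ci : continuous i) (ip : i point = point) (injI : injective i).
Hypotheses (clI : forall C : set A, closed C -> closed (i @` C)).
Hypothesis clp : closed [set (point : X)].
Hypothesis ctheta : continuous theta.
Hypothesis theta_point : forall w, theta (point, w) = point.
Hypothesis theta_A : forall a w, range j (theta (i a, w)).

Definition pull (x : X) : A := xget point [set a | i a = x].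

Lemma pullK : cancel i pull.
Proof.
move=> a; apply: injI; rewrite /pull.
by apply: (@xgetPex _ point [set b | i b = i a]); exists a.
Qed.

(** Each letter is sent to the value of theta on it and on the word that
    follows it. *)
Fixpoint ext_letters (s : seq X) : seq Z :=
  if s is x :: s' then theta (x, reduce [seq pull y | y <- s']) :: ext_letters s'
  else [::].

Lemma reduce_pull (s : seq X) :
  reduce [seq pull y | y <- [seq z <- s | z != point]] =
  reduce [seq pull y | y <- s].
Proof.
have pp : pull point = point by rewrite -{1}ip pullK.
apply: val_inj => /=; elim: s => //= x s IH.
by have [->|x_neq0] /= := eqVneq x point; rewrite ?pp ?eqxx IH.
Qed.

(** Independence of the representing word: basepoints contribute basepoints
    by [theta_point], and the arguments of theta are already reduced. *)
Lemma reduce_ext_letters (s : seq X) :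
  reduce (ext_letters [seq z <- s | z != point]) = reduce (ext_letters s).
Proof.
apply: val_inj => /=; elim: s => //= x s IH.
have [->|x_neq0] /= := eqVneq x point; first by rewrite theta_point eqxx.
by rewrite reduce_pull IH.
Qed.

Lemma ext_letters_range (s : seq X) :
  (forall x, x \in s -> range i x) ->
  forall z, z \in ext_letters s -> range j z.
Proof.
elim: s => //= x s IH si z; rewrite inE => /orP[/eqP ->|].
  by have [a _ <-] := si x (mem_head _ _); exact: theta_A.
by apply: IH => y ys; apply: si; rewrite inE ys orbT.
Qed.

Lemma ext_later (w : James X) :
  later_letters i w -> later_letters j (reduce (ext_letters (word w))).
Proof.
rewrite /later_letters /=; case: (word w) => [|x s] /= si; first by [].
by apply: reduce_later; exact: ext_letters_range.
Qed.

Definition ext (w : RelJames i) : RelJames j :=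
  SigSub (mem_set (ext_later (set_mem (valP (w : set_type _))))).

Fixpoint ext_vec (n : nat) : kpow A n -> kpow Z n :=
  if n is n'.+1 then
    fun v => (theta (i v.1, reduce (letters v.2)), ext_vec v.2)
  else fun v => v.

Lemma letters_ext_vec n (v : kpow A n) :
  letters (ext_vec v) = ext_letters [seq i a | a <- letters v].
Proof.
by elim: n v => //= n IH v; rewrite IH -map_comp (eq_map pullK) map_id.
Qed.

Lemma continuous_ext_vec n : continuous (@ext_vec n).
Proof.
elim: n => [|n IH] /=; first by move=> v.
have c1 := @continuous_kfst A (kpow A n).
have c2 := @continuous_ksnd A (kpow A n).
have cgp := @cg_kification (A * kpow A n)%type.
apply: continuous_kpair => //; last exact: (continuous_compose c2 IH).
apply: (@continuous_compose _ _ _ (fun v : kprod A (kpow A n) =>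
  (i v.1, reduce (letters v.2)) : kprod X (James A)) _ _ ctheta).
apply: continuous_kpair => //; first exact: (continuous_compose c1 ci).
exact: (continuous_compose c2 (@continuous_reduce A n)).
Qed.

(** On X times a power of A the map is the vector of the values of theta
    followed by the reduction of words. *)
Lemma continuous_ext : continuous ext.
Proof.
apply: continuous_kification; first exact: cg_kification.
apply: continuous_to_set_type; apply/continuous_closedP => D clD.
(* The subspace topology is reached through a closed set of James X. *)
pose E := [set w | later_letters i w /\ D (reduce (ext_letters (word w)))].
have clE : closed E.
  apply: (closed_later_letters ip injI clI clp) => [w []//|n].
  pose f (p : kprod X (kpow A n)) : James Z := reduce (letters
    ((theta (p.1, reduce (letters p.2)), ext_vec p.2) : kpow Z n.+1)).
  have c1 := @continuous_kfst X (kpow A n).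
  have c2 := @continuous_ksnd X (kpow A n).
  have cgp := @cg_kification (X * kpow A n)%type.
  have cf : continuous f.
    apply: (@continuous_compose _ _ _ _ _ _ (@continuous_reduce Z n.+1)).
    apply: continuous_kpair => //; last first.
      exact: (continuous_compose c2 (@continuous_ext_vec n)).
    apply: (@continuous_compose _ _ _ (fun v : kprod X (kpow A n) =>
      (v.1, reduce (letters v.2)) : kprod X (James A)) _ _ ctheta).
    apply: continuous_kpair => //.
    exact: (continuous_compose c2 (@continuous_reduce A n)).
  rewrite (_ : [set _ | _] = f @^-1` D).
    by move/continuous_closedP: cf; apply.
  have fE p : f p =
      reduce (ext_letters (word (reduce (p.1 :: [seq i a | a <- letters p.2])))).
    rewrite word_reduce reduce_ext_letters /f /= letters_ext_vec.
    by rewrite -map_comp (eq_map pullK) map_id.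
  apply/seteqP; split=> p; first by case; rewrite -fE.
  move=> Dp; split; last by rewrite -fE.
  by apply: reduce_later => y /mapP[a _ ->]; exists a.
rewrite (_ : _ @^-1` _ = (fun w : RelJames i => set_val w) @^-1` E).
  have cv : continuous (fun w : RelJames i => set_val w : James X).
    have h := @continuous_unkification (set_type (later_letters i)).
    apply: (@continuous_compose (RelJames i) (set_type (later_letters i)) _ _ _ h).
    exact: initial_continuous.
  by move/continuous_closedP: cv; apply.
apply/seteqP; split=> w /=; last by case.
by move=> Dw; split=> //; exact: set_mem (valP (w : set_type _)).
Qed.

Lemma ext_point : ext point = point.
Proof. by do 2 apply: val_inj. Qed.

(** If theta(x, w) is not the basepoint, it is the first letter of the
    extension.  If it is, the first letter is in the image of j or absent, and
    both sides are the basepoint. *)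
Lemma rel_rho_ext x w :
  rel_rho (ext (rel_mul i (x, w))) = collapse_pi (range j) (theta (x, w)).
Proof.
set s := [seq i a | a <- word w].
have si y : y \in s -> range i y by case/mapP=> a _ ->; exists a.
have p0 : range j point by rewrite -(theta_point point) -ip; exact: theta_A.
have thetaE : theta (x, reduce [seq pull y | y <- s]) = theta (x, w).
  by rewrite /s -map_comp (eq_map pullK) map_id reduce_word.
have wE : word (set_val (ext (rel_mul i (x, w)))) =
    [seq z <- theta (x, w) :: ext_letters s | z != point].
  by rewrite -thetaE; exact: (congr1 val (reduce_ext_letters (x :: s))).
rewrite /rel_rho wE /=; have [->|//] := eqVneq (theta (x, w)) point.
apply/collapse_pi_eqP; right; split=> //=.
have := @mem_filter _ (fun z => z != point) _ (ext_letters s).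
case: [seq _ <- _ | _] => [//|z t] /(_ z).
by rewrite mem_head => /esym/andP[_]; exact: ext_letters_range.
Qed.

End extension.

(** * The theorem *)

Theorem theorem5p1 (R : realType) (p : nat) (X' A' : ptopologicalType)
    (i' : A' -> X') (r : nat) :
  prime p -> (2 < p)%N ->
  compactly_generated X' -> weak_hausdorff X' -> closed_inclusion i' ->
  let X := Susp R X' in
  let A := Susp R A' in
  let i : A -> X := susp_map i' in
  cofibration R i -> p_local R p X -> p_local R p A ->
  (1 <= r)%N ->
  let B := smash_pow A r.-1 in
  let j : Smash A B -> Smash X B := smash_map i idfun in
  forall (u : B -> R), letter_length u ->
  forall (H : James A -> James B), continuous H ->
  exists h : RelJames i -> RelJames j,
    [/\ continuous h, h point = point &
        @homotopic R (kprod X (James A)) (quotient_by j)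
          (fun xw => rel_rho (h (rel_mul i xw)))
          (fun xw => collapse_pi (range j)
                       (alpha u (smash_pi xw.1 (H xw.2))))].
Proof.
move=> _ _ _ whX [ci injI ip clI] X A i _ _ _ _ B j u lu H cH.
have cgB : compactly_generated B.
  rewrite /B; case: (r.-1) => [|k]; last exact: cg_Smash.
  by move=> U _; exact: discrete_open.
have clp : closed [set (point : X')] by exact: weak_hausdorff_closed1.
pose theta (xw : kprod X (James A)) := alpha u (smash_pi xw.1 (H xw.2)).
have ctheta : continuous theta.
  have ca := @continuous_alpha R B u cgB lu X'.
  have cs : continuous (fun xw : kprod X (James A) => smash_pi xw.1 (H xw.2)).
    apply: continuous_smash_pi; first exact: cg_kification.
      exact: continuous_kfst.
    exact: (continuous_compose (@continuous_ksnd X (James A)) cH).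
  exact: (continuous_compose cs ca).
have theta_point w : theta (point, w) = point by exact: alpha_pointl.
have theta_A a w : range j (theta (i a, w)).
  by rewrite /theta /= alpha_natural //; exists (alpha u (smash_pi a (H w))).
have iI : injective i by exact: susp_map_inj.
have ip' : i point = point by exact: susp_map_point.
have icl : forall C : set A, closed C -> closed (i @` C).
  exact: closed_susp_map.
exists (ext theta_A); split.
- apply: continuous_ext => //; first exact: continuous_susp_map.
  exact: closed1_Susp.
- exact: ext_point.
exists (fun q => collapse_pi (range j) (theta q.1)); split.
- apply: continuous_compose (@continuous_collapse_pi (Smash X B) (range j)).
  exact: (continuous_compose (@continuous_kfst _ (unit_interval R)) ctheta).
- by move=> [x w]; rewrite rel_rho_ext.
- by [].
- by move=> t; rewrite theta_point.
Qed.
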